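(* Let $(X,d)$ be a nonempty metric space, $k\geq 2$ an integer, and $1\leq p<\infty$. The assignments $\mathcal F_{k,p}:\mathbf{PowPres}_{k,p}(X)\to\mathbf{PowStr}_{k,p}(X)$ and $\mathcal G_{k,p}:\mathbf{PowStr}_{k,p}(X)\to\mathbf{PowPres}_{k,p}(X)$ (defined in the context) are functors, and they form an equivalence of categories. Moreover, $\mathcal F_{k,p}\mathcal G_{k,p}=\mathrm{id}_{\mathbf{PowStr}_{k,p}(X)}$, and there is a natural isomorphism $\eta:\mathcal G_{k,p}\mathcal F_{k,p}\Rightarrow\mathrm{id}_{\mathbf{PowPres}_{k,p}(X)}$. Consequently, the isomorphism classes of ordered $\ell^p$ $k$-power presentations of $(X,d)$ (objects of $\mathbf{PowPres}_{k,p}(X)$) correspond bijectively to ordered $\ell^p$ $k$-power structures on $(X,d)$. The category $\mathbf{PowPres}_{k,p}(X)$ is thin (there is at most one morphism between any two objects), and every ordered $\ell^p$ $k$-power presentation has trivial automorphism group.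
   Context: All metric spaces are nonempty and all isometries are bijective. For a metric space $(P,d_P)$, $\Delta_{k,p}(P)$ is $P^k$ with metric $d_{P^k,p}(u,v)=\big(\sum_{j=1}^k d_P(u_j,v_j)^p\big)^{1/p}$; $\pi_j:P^k\to P$ is the $j$-th projection; for $f:P\to Q$, $f^{\times k}:P^k\to Q^k$ is the coordinatewise map. For an equivalence relation $E$ on $X$, $\bar d_E([x]_E,[y]_E):=\inf\{d(x',y'):x'Ex,\ y'Ey\}$. Category $\mathbf{PowPres}_{k,p}(X)$: objects are pairs $(P,\phi)$ with $(P,d_P)$ a metric space and $\phi:\Delta_{k,p}(P)\to(X,d)$ an isometry; a morphism $(P,\phi)\to(Q,\psi)$ is an isometry $f:P\to Q$ with $\psi\circ f^{\times k}=\phi$. An ordered $\ell^p$ $k$-power structure on $(X,d)$ is a tuple $(E_1,\dots,E_k,\tau_2,\dots,\tau_k)$ where $E_1,\dots,E_k$ are equivalence relations on $X$ and $\tau_j:X/E_j\to X/E_1$ ($2\leq j\leq k$) are maps such that: (i) each $\bar d_{E_j}$ is a metric on $X/E_j$; (ii) for all classes $C_j\in X/E_j$ ($1\le j\le k$), $\bigcap_{j=1}^k C_j$ is exactly one point; (iii) $d(x,y)=\big(\sum_{j=1}^k\bar d_{E_j}([x]_{E_j},[y]_{E_j})^p\big)^{1/p}$ for all $x,y\in X$; (iv) each $\tau_j:(X/E_j,\bar d_{E_j})\to(X/E_1,\bar d_{E_1})$ is an isometry. $\mathbf{PowStr}_{k,p}(X)$ is the discrete category (only identity morphisms) of such structures.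 $\mathcal F_{k,p}$: given $(P,\phi)$, put $q_j^\phi:=\pi_j\circ\phi^{-1}:X\to P$, let $xE_j^\phi y$ iff $q_j^\phi(x)=q_j^\phi(y)$, let $\bar q_j^\phi:X/E_j^\phi\to P$ be the induced map, and $\tau_j^\phi:=(\bar q_1^\phi)^{-1}\circ\bar q_j^\phi$. Then $\mathcal F_{k,p}(P,\phi):=(E_1^\phi,\dots,E_k^\phi,\tau_2^\phi,\dots,\tau_k^\phi)$; a morphism $(P,\phi)\to(Q,\psi)$ is sent to the identity of the common value $\mathcal F_{k,p}(P,\phi)=\mathcal F_{k,p}(Q,\psi)$. $\mathcal G_{k,p}$: given $\mathfrak s=(E_1,\dots,E_k,\tau_2,\dots,\tau_k)$, put $P_{\mathfrak s}:=(X/E_1,\bar d_{E_1})$ and $\Psi_{\mathfrak s}:X\to P_{\mathfrak s}^k$, $\Psi_{\mathfrak s}(x)=([x]_{E_1},\tau_2([x]_{E_2}),\dots,\tau_k([x]_{E_k}))$; then $\mathcal G_{k,p}(\mathfrak s):=(P_{\mathfrak s},\Psi_{\mathfrak s}^{-1})$, and identities go to identities. The components of $\eta$ are $\eta_{(P,\phi)}:=\bar q_1^\phi:X/E_1^\phi\to P$. *)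

(* Defs.v *)
From HB Require Import structures.
From mathcomp Require Import all_boot all_order all_algebra.
From mathcomp Require Import all_classical all_reals all_analysis.

Set Implicit Arguments.
Unset Strict Implicit.
Unset Printing Implicit Defensive.

Import Order.TTheory GRing.Theory Num.Theory.

Local Open Scope classical_set_scope.
Local Open Scope ring_scope.

Record category := Category {
  obj :> Type;
  hom : obj -> obj -> Type;
  idm : forall a, hom a a;
  comp : forall a b c, hom b c -> hom a b -> hom a c;
  comp1m : forall a b (f : hom a b), comp (idm b) f = f;
  compm1 : forall a b (f : hom a b), comp f (idm a) = f;
  compA : forall a b c d (h : hom c d) (g : hom b c) (f : hom a b),
    comp h (comp g f) = comp (comp h g) f }.

Arguments idm {c} a : rename.
Arguments comp {c a b} {_} g f : rename.

Record functor (C D : category) := Functor {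
  fobj :> C -> D;
  fmap : forall a b, hom a b -> hom (fobj a) (fobj b);
  fmap1 : forall a, fmap (idm a) = idm (fobj a);
  fmapM : forall a b c (g : hom b c) (f : hom a b),
    fmap (comp g f) = comp (fmap g) (fmap f) }.

Definition functor_id (C : category) : functor C C :=
  @Functor C C id (fun _ _ f => f) (fun _ => erefl) (fun _ _ _ _ _ => erefl).

Lemma functor_comp1 (C D E : category) (G : functor D E) (F : functor C D) a :
  fmap G (fmap F (idm a)) = idm (G (F a)).
Proof. by rewrite !fmap1. Qed.

Lemma functor_compM (C D E : category) (G : functor D E) (F : functor C D)
    a b c (g : hom b c) (f : hom a b) :
  fmap G (fmap F (comp g f)) = comp (fmap G (fmap F g)) (fmap G (fmap F f)).
Proof. by rewrite !fmapM. Qed.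

Definition functor_comp (C D E : category) (G : functor D E) (F : functor C D) :
    functor C E :=
  @Functor C E (fun a => G (F a)) (fun _ _ f => fmap G (fmap F f))
    (functor_comp1 G F) (functor_compM G F).

Definition is_iso (C : category) (a b : C) (f : hom a b) : Prop :=
  exists g : hom b a, comp g f = idm a /\ comp f g = idm b.

Definition isomorphic (C : category) (a b : C) : Prop :=
  exists f : hom a b, is_iso f.

Record nat_iso (C D : category) (F G : functor C D) := NatIso {
  nt_comp :> forall a, hom (F a) (G a);
  nt_natural : forall a b (f : hom a b),
    comp (nt_comp b) (fmap F f) = comp (fmap G f) (nt_comp a);
  nt_iso : forall a, is_iso (nt_comp a) }.

Definition equivalence_of_categories (C D : category)
    (F : functor C D) (G : functor D C) : Prop :=
  inhabited (nat_iso (functor_comp G F) (functor_id C)) /\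
  inhabited (nat_iso (functor_comp F G) (functor_id D)).

Definition iso_class (C : category) : Type :=
  {S : C -> Prop | exists a, S = isomorphic a}.

Definition iso_class_of (C : category) (a : C) : iso_class C :=
  exist (fun S => exists b, S = isomorphic b) (isomorphic a)
    (ex_intro _ a erefl).

Definition thin (C : category) : Prop :=
  forall (a b : C) (f g : hom a b), f = g.

Definition trivial_automorphisms (C : category) : Prop :=
  forall (a : C) (f : hom a a), is_iso f -> f = idm a.

Definition discrete_category (T : Type) : category :=
  @Category T (fun a b => a = b) (@erefl T)
    (fun _ _ _ bc ab => etrans ab bc)
    (fun _ _ _ => Prop_irrelevance _ _) (fun _ _ _ => Prop_irrelevance _ _)
    (fun _ _ _ _ _ _ _ => Prop_irrelevance _ _).

Lemma discrete_thin (T : Type) : thin (discrete_category T).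
Proof. by move=> a b f g; exact: (@Prop_irrelevance (a = b)). Qed.

Record is_metric (R : realType) (T : Type) (d : T -> T -> R) : Prop :=
  IsMetric {
  is_metric_ge0 : forall x y, 0 <= d x y;
  is_metric_eq0 : forall x y, d x y = 0 <-> x = y;
  is_metric_sym : forall x y, d x y = d y x;
  is_metric_triangle : forall y x z, d x z <= d x y + d y z }.

Definition is_isometry (R : realType) (A B : Type)
    (dA : A -> A -> R) (dB : B -> B -> R) (f : A -> B) : Prop :=
  bijective f /\ forall x y, dB (f x) (f y) = dA x y.

Definition powdist (R : realType) (P : metricType R) (k : nat) (p : R)
    (u v : 'I_k -> P) : R :=
  (\sum_(j < k) mdist (u j) (v j) `^ p) `^ p^-1.

(* The inverse function of a bijection [f]; it is total, [hA] only providing the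
   value of [inverse hA f] outside the range of [f]. *)
Definition inverse (A B : Type) (hA : inhabited A) (f : A -> B) : B -> A :=
  pinv_ (fun=> inhabited_witness hA) [set: A] f.

(* [class E x] is the set of all [y] with [E x y]; quotients are only used for
   equivalence relations, but the definitions make sense for any [E]. *)
Definition quotient (X : Type) (E : X -> X -> Prop) : Type :=
  {C : X -> Prop | exists x, C = E x}.

Definition class (X : Type) (E : X -> X -> Prop) (x : X) : quotient E :=
  exist (fun C => exists x, C = E x) (E x) (ex_intro _ x erefl).

Definition in_class (X : Type) (E : X -> X -> Prop) (C : quotient E) (x : X) :
  Prop := sval C x.

Definition repr (X : Type) (E : X -> X -> Prop) (C : quotient E) : X :=
  sval (cid (svalP C)).

(* The map [X/E -> P] induced by [f]; it satisfies
   [induced f (class E x) = f x] whenever [f] is constant on classes. *)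
Definition induced (X P : Type) (E : X -> X -> Prop) (f : X -> P) :
  quotient E -> P := fun C => f (repr C).

Lemma quotient_inhabited (X : Type) (E : X -> X -> Prop) :
  inhabited X -> inhabited (quotient E).
Proof. by case=> x; exists; exact: class E x. Qed.

HB.instance Definition _ (X : Type) (E : X -> X -> Prop) :=
  gen_eqMixin (quotient E).
HB.instance Definition _ (X : Type) (E : X -> X -> Prop) :=
  gen_choiceMixin (quotient E).

Definition quotient_dist (R : realType) (X : metricType R)
    (E : X -> X -> Prop) (C D : quotient E) : R :=
  inf [set r | exists x y, [/\ in_class C x, in_class D y & r = mdist x y]].

Section quotient_metric.
Context (R : realType) (X : metricType R) (E : X -> X -> Prop).
Hypothesis hE : is_metric (@quotient_dist R X E).
Let dist := @quotient_dist R X E.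

Let dist0 C : dist C C = 0.
Proof. exact/(is_metric_eq0 hE). Qed.

Let dist_eq0 C D : dist C D = 0 -> C = D.
Proof. by move/(is_metric_eq0 hE). Qed.

Definition quotient_metric : metricType R :=
  HB.pack (quotient E) (@isMetric.Build R (quotient E) dist
    dist0 dist_eq0 (is_metric_sym hE) (is_metric_triangle hE)).
End quotient_metric.

Record presentation (R : realType) (X : metricType R) (k : nat) (p : R) :=
  Presentation {
  pres_space : metricType R;
  pres_nonempty : inhabited pres_space;
  pres_map : ('I_k -> pres_space) -> X;
  pres_isometry : is_isometry (@powdist R pres_space k p) mdist pres_map }.

Section PowPres.
Context (R : realType) (X : metricType R) (k : nat) (p : R).
Implicit Types A B C D : presentation X k p.

Definition is_pres_hom A B (f : pres_space A -> pres_space B) : Prop :=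
  is_isometry mdist mdist f /\
  forall u : 'I_k -> pres_space A, pres_map (fun j => f (u j)) = pres_map u.

Definition pres_hom A B : Type := {f | @is_pres_hom A B f}.

Lemma is_pres_hom_id A : @is_pres_hom A A id.
Proof. by split=> //; split=> //; exists id. Qed.

Lemma is_pres_hom_comp A B C (g : pres_hom B C) (f : pres_hom A B) :
  @is_pres_hom A C (sval g \o sval f).
Proof.
case: f g => [f [[fb fd] fm]] [g [[gb gd] gm]] /=; split=> [|u].
  by split=> [|x y]; [exact: bij_comp | rewrite /= gd fd].
by rewrite -fm -gm.
Qed.

Definition pres_id A : pres_hom A A := exist _ id (is_pres_hom_id A).

Definition pres_comp A B C (g : pres_hom B C) (f : pres_hom A B) :
  pres_hom A C := exist _ (sval g \o sval f) (is_pres_hom_comp g f).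

Lemma pres_hom_eq A B (f g : pres_hom A B) : sval f = sval g -> f = g.
Proof. by case: f g => [f fP] [g gP] /= e; apply: eq_exist. Qed.

Definition PowPres : category :=
  @Category (presentation X k p) pres_hom pres_id pres_comp
    (fun _ _ f => @pres_hom_eq _ _ (pres_comp (pres_id _) f) f erefl)
    (fun _ _ f => @pres_hom_eq _ _ (pres_comp f (pres_id _)) f erefl)
    (fun _ _ _ _ h g f => @pres_hom_eq _ _
       (pres_comp h (pres_comp g f)) (pres_comp (pres_comp h g) f) erefl).
End PowPres.

(* Indices are shifted by one: [E_1] is [rels (ord_first hk)], and the maps
   [tau_2, ..., tau_k] are indexed by the [j : 'I_k] with [0 < j]. *)
Definition ord_first (k : nat) (hk : (2 <= k)%N) : 'I_k := Ordinal (ltnW hk).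

Record power_data (X : Type) (k : nat) (hk : (2 <= k)%N) := PowerData {
  rels : 'I_k -> X -> X -> Prop;
  taus : forall j : 'I_k, (0 < j)%N ->
    quotient (rels j) -> quotient (rels (ord_first hk)) }.

Record is_power_structure (R : realType) (X : metricType R) (k : nat)
    (hk : (2 <= k)%N) (p : R) (s : power_data X hk) : Prop :=
  IsPowerStructure {
  ps_equiv : forall j, RelationClasses.Equivalence (rels s j);
  ps_metric : forall j, is_metric (@quotient_dist R X (rels s j));
  ps_point : forall C : (forall j, quotient (rels s j)),
    exists! x, forall j, in_class (C j) x;
  ps_dist : forall x y : X, mdist x y =
    (\sum_(j < k) quotient_dist (X := X) (class (rels s j) x) (class (rels s j) y) `^ p)
      `^ p^-1;
  ps_tau : forall (j : 'I_k) (hj : (0 < j)%N),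
    is_isometry (@quotient_dist R X _) (@quotient_dist R X _)
      (@taus _ _ _ s j hj) }.

Definition power_structure (R : realType) (X : metricType R) (k : nat)
    (hk : (2 <= k)%N) (p : R) : Type :=
  {s : power_data X hk | is_power_structure p s}.

Definition PowStr (R : realType) (X : metricType R) (k : nat)
    (hk : (2 <= k)%N) (p : R) : category :=
  discrete_category (power_structure X hk p).

Section functorF.
Context (R : realType) (X : metricType R) (hX : inhabited X).
Context (k : nat) (hk : (2 <= k)%N) (p : R).
Implicit Types A B : presentation X k p.

Lemma pres_pow_inhabited A : inhabited ('I_k -> pres_space A).
Proof. by case: (pres_nonempty A) => a; exists=> _. Qed.

Definition pres_q A (j : 'I_k) (x : X) : pres_space A :=
  inverse (pres_pow_inhabited A) (@pres_map _ _ _ _ A) x j.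

Definition pres_rel A (j : 'I_k) (x y : X) : Prop := pres_q A j x = pres_q A j y.

Definition pres_qbar A (j : 'I_k) : quotient (pres_rel A j) -> pres_space A :=
  induced (pres_q A j).

Definition pres_tau A (j : 'I_k) :
    quotient (pres_rel A j) -> quotient (pres_rel A (ord_first hk)) :=
  inverse (quotient_inhabited _ hX) (@pres_qbar A (ord_first hk)) \o
  @pres_qbar A j.

Definition F_data A : power_data X hk :=
  PowerData (fun j _ => @pres_tau A j).

Hypothesis F_wf : forall A, is_power_structure p (F_data A).

Definition F_obj A : power_structure X hk p := exist _ (F_data A) (F_wf A).

Hypothesis F_hom : forall A B, pres_hom A B -> F_obj A = F_obj B.

Definition F_functor : functor (PowPres X k p) (PowStr X hk p) :=
  @Functor (PowPres X k p) (PowStr X hk p) F_obj F_hom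
    (fun _ => discrete_thin _ _) (fun _ _ _ _ _ => discrete_thin _ _).
End functorF.

Section functorG.
Context (R : realType) (X : metricType R) (hX : inhabited X).
Context (k : nat) (hk : (2 <= k)%N) (p : R).
Implicit Types s t : power_structure X hk p.

Definition str_space s : metricType R :=
  quotient_metric (ps_metric (svalP s) (ord_first hk)).

Lemma str_space_inhabited s : inhabited (str_space s).
Proof. exact: quotient_inhabited. Qed.

Definition str_Psi s (x : X) (j : 'I_k) : str_space s :=
  match boolP (0 < j)%N with
  | AltTrue hj => taus hj (class (rels (sval s) j) x)
  | AltFalse _ => class (rels (sval s) (ord_first hk)) x
  end.

Hypothesis G_wf : forall s,
  is_isometry (@powdist R (str_space s) k p) mdist (inverse hX (str_Psi s)).

Definition G_obj s : presentation X k p :=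
  Presentation (str_space_inhabited s) (G_wf s).

(* All morphisms [s = t] of the discrete category are identities. *)
Definition G_hom s t (e : s = t) : pres_hom (G_obj s) (G_obj t) :=
  match e with erefl => pres_id (G_obj s) end.

Lemma G_homM s t r (e' : t = r) (e : s = t) :
  G_hom (etrans e e') = pres_comp (G_hom e') (G_hom e).
Proof. by case: r / e'; case: t / e; apply: pres_hom_eq. Qed.

Definition G_functor : functor (PowStr X hk p) (PowPres X k p) :=
  @Functor (PowStr X hk p) (PowPres X k p) G_obj G_hom
    (fun _ => erefl) (fun s t r e' e => G_homM e' e).
End functorG.

(* Main.v *)
Require Import Defs.
From mathcomp Require Import all_boot all_order all_algebra.
From mathcomp Require Import all_classical all_reals all_analysis.

(** A presentation [phi : P^k -> X] is determined up to a unique isomorphism by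
the fibres of its coordinate functions [q_j], together with the rule that says
when the [j]-th coordinate of [x] equals the first coordinate of [y].

The first step recovers the metric of [P] from the fibres.  Moving one
coordinate of a point of [P^k] and fixing the others produces, over any two
values of the [j]-th coordinate, two points whose distance is exactly that of
the two values, while no pair of points over these values can be closer, as
every term of the [l^p] sum is nonnegative.  So the infimum that defines the
quotient distance is attained and [qbar_j : X/E_j -> P] is an isometry
([pres_qbar_isometry]).  The axioms of a power structure are then read off
from [P^k] through the [qbar_j] ([F_data_wf]).

Conversely, for a power structure the map [Psi] identifies [X] with
[(X/E_1)^k]: as every [tau_j] is bijective, prescribing the coordinates of
[Psi x] amounts to prescribing the classes of [x], which singles out one point,
and the distance formula makes [Psi] an isometry ([str_Psi_isometry]).  The
[j]-th coordinate function of the resulting presentation is the [j]-th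
component of [Psi] ([pres_q_G_obj]).  Its fibres are the classes of [E_j], and
it takes at [x] the value of the first one at [y] exactly when [tau_j] sends
the class of [x] to the class of [y]: hence [F G = id] ([F_data_G_obj]).

The natural isomorphism is [qbar_1], which is a morphism because
[qbar_1 o tau_j = qbar_j] ([pres_qbar_hom]).  The remaining claims are formal.
Morphisms intertwine the coordinate functions ([pres_q_hom]), which are
surjective, so there is at most one morphism between two presentations
([pres_hom_thin]); this makes naturality automatic and automorphisms trivial.
Every morphism is invertible ([pres_hom_iso]), so the components of the natural
transformation are isomorphisms, and a functor to a discrete category that has
a strict section, inverse to it up to isomorphism, classifies the objects up to
isomorphism ([iso_class_classification]). *)

Set Implicit Arguments.
Unset Strict Implicit.
Unset Printing Implicit Defensive.

Import Order.TTheory GRing.Theory Num.Theory.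

Local Open Scope ring_scope.

(** * Bijections, quotients and transport of metrics *)

Lemma inj_surj_bijective (A B : Type) (f : A -> B) :
  injective f -> (forall b, exists a, f a = b) -> bijective f.
Proof.
move=> finj fsurj; rewrite -setTT_bijective; split=> //.
  by move=> x y _ _; exact: finj.
by move=> b _; have [a ab] := fsurj b; exists a.
Qed.

Lemma bijective_surj (A B : Type) (f : A -> B) :
  bijective f -> forall b, exists a, f a = b.
Proof. by case=> g _ fg b; exists (g b). Qed.

Section inverse.
Context (A B : Type) (hA : inhabited A) (f : A -> B).

Lemma inverseK : injective f -> cancel f (inverse hA f).
Proof.
by move=> finj a; apply: pinvKV; rewrite ?inE// => x y _ _; exact: finj.
Qed.

Hypothesis fbij : bijective f.

Lemma inverseKV : cancel (inverse hA f) f.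
Proof.
move=> b; have [a <-] := bijective_surj fbij b.
by rewrite inverseK//; exact: bij_inj.
Qed.

Lemma inverse_bijective : bijective (inverse hA f).
Proof.
by exists f; [exact: inverseKV | apply: inverseK; exact: bij_inj].
Qed.
End inverse.

Section quotients.
Context (X : Type) (E : X -> X -> Prop).

Lemma class_repr (C : quotient E) : class E (Defs.repr C) = C.
Proof.
case: C => C HC; apply: eq_exist; rewrite /Defs.repr /=.
by case: cid.
Qed.

Lemma class_surj (C : quotient E) : exists x, C = class E x.
Proof. by exists (Defs.repr C); rewrite class_repr. Qed.

Hypothesis hE : RelationClasses.Equivalence E.

Lemma class_eqP x y : class E x = class E y <-> E x y.
Proof.
case: hE => refl sym trans; split=> [/(congr1 sval) /= ->|xy].
  exact: refl.
apply: eq_exist; apply/funext => z; apply/propext; split=> ?.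
  by apply: trans; [exact: sym xy | ].
exact: trans xy _.
Qed.

Lemma in_classP (C : quotient E) x : in_class C x <-> C = class E x.
Proof. by have [y ->] := class_surj C; rewrite class_eqP. Qed.

Lemma induced_class (P : Type) (f : X -> P) :
  (forall x y, E x y -> f x = f y) ->
  forall x, Defs.induced f (class E x) = f x.
Proof.
by move=> fE x; rewrite /Defs.induced; apply: fE; rewrite -class_eqP class_repr.
Qed.
End quotients.

Section metrics.
Context (R : realType).

Lemma mdist_is_metric (T : metricType R) : is_metric (@mdist R T).
Proof.
split.
- exact: mdist_ge0.
- by move=> x y; split=> [/mdist_positivity//|->]; rewrite mdistxx.
- exact: metric_sym.
- by move=> y x z; exact: metric_triangle.
Qed.

Lemma is_metric_pullback (A B : Type) (dA : A -> A -> R) (dB : B -> B -> R)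
    (f : A -> B) :
  injective f -> (forall x y, dB (f x) (f y) = dA x y) ->
  is_metric dB -> is_metric dA.
Proof.
move=> finj fd [d0 deq dsym dtri]; split=> [x y|x y|x y|y x z]; rewrite -!fd//.
by split=> [/deq/finj|->]; last exact/deq.
Qed.

Lemma is_isometry_comp (A B C : Type) (dA : A -> A -> R) (dB : B -> B -> R)
    (dC : C -> C -> R) (g : B -> C) (f : A -> B) :
  is_isometry dB dC g -> is_isometry dA dB f -> is_isometry dA dC (g \o f).
Proof.
move=> [gb gd] [fb fd]; split; first exact: bij_comp.
by move=> x y /=; rewrite gd fd.
Qed.

Lemma is_isometry_inverse (A B : Type) (hA : inhabited A)
    (dA : A -> A -> R) (dB : B -> B -> R) (f : A -> B) :
  is_isometry dA dB f -> is_isometry dB dA (inverse hA f).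
Proof.
move=> [fb fd]; split; first exact: inverse_bijective.
by move=> x y; rewrite -fd !inverseKV.
Qed.

(** In all quotients of interest here the infimum is a minimum, and it is
computed by exhibiting a pair that attains it. *)
Lemma quotient_dist_min (X : metricType R) (E : X -> X -> Prop)
    (C D : quotient E) (r : R) :
  (exists x y, [/\ in_class C x, in_class D y & mdist x y = r]) ->
  (forall x y, in_class C x -> in_class D y -> r <= mdist x y) ->
  quotient_dist C D = r.
Proof.
move=> [x [y [Cx Dy xyr]]] rmin; apply/le_anti/andP; split.
  apply: ge_inf; last by exists x, y.
  by exists 0 => _ [? [? [_ _ ->]]]; exact: mdist_ge0.
apply: lb_le_inf; first by exists r, x, y.
by move=> _ [u [v [Cu Dv ->]]]; exact: rmin.
Qed.

Section powdist.
Context (P : metricType R) (k : nat) (p : R).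
Hypothesis p0 : 0 < p.

Lemma powR_root (a : R) : 0 <= a -> (a `^ p) `^ p^-1 = a.
Proof. by move=> a0; rewrite -powRrM divff ?gt_eqF// powRr1. Qed.

Lemma coord_le_powdist (u v : 'I_k -> P) j :
  mdist (u j) (v j) <= powdist p u v.
Proof.
rewrite -[leLHS]powR_root ?mdist_ge0//.
apply: ge0_ler_powR; rewrite ?invr_ge0 ?nnegrE ?powR_ge0//; first exact: ltW.
  by apply: sumr_ge0 => i _; exact: powR_ge0.
rewrite (bigD1 j)//= lerDl; apply: sumr_ge0 => i _; exact: powR_ge0.
Qed.

(** Each coordinate slice of the power is an isometric copy of the space. *)
Lemma powdist_coord (u v : 'I_k -> P) j :
  (forall i, i != j -> u i = v i) -> powdist p u v = mdist (u j) (v j).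
Proof.
move=> uv; rewrite /powdist (bigD1 j)//= big1 ?addr0 ?powR_root ?mdist_ge0//.
by move=> i /uv ->; rewrite mdistxx powR0 ?gt_eqF.
Qed.
End powdist.
End metrics.

(** * From presentations to structures *)

Section presentations.
Context (R : realType) (X : metricType R) (k : nat) (p : R).
Implicit Types A B : presentation X k p.

Lemma pres_map_bij A : bijective (@pres_map _ _ _ _ A).
Proof. by have [] := pres_isometry A. Qed.

Lemma pres_q_map A (u : 'I_k -> pres_space A) j : pres_q A j (pres_map u) = u j.
Proof. by rewrite /pres_q inverseK//; apply: bij_inj; exact: pres_map_bij. Qed.

Lemma pres_map_q A x : pres_map (fun j => pres_q A j x) = x.
Proof.
have [u <-] := bijective_surj (pres_map_bij A) x.
by congr pres_map; apply/funext => j; exact: pres_q_map.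
Qed.

Lemma pres_mdist A x y :
  mdist x y = powdist p (pres_q A ^~ x) (pres_q A ^~ y).
Proof.
by rewrite -{1}(pres_map_q A x) -{1}(pres_map_q A y) (pres_isometry A).2.
Qed.

Lemma pres_q_surj A j a : exists x, pres_q A j x = a.
Proof. by exists (pres_map (fun=> a)); rewrite pres_q_map. Qed.

(** A morphism can only send the [j]-th coordinate of a point of [X] to the
[j]-th coordinate of the same point; thinness of the category and the
invariance of the associated structure both rest on this. *)
Lemma pres_q_hom A B (f : pres_hom A B) j x :
  pres_q B j x = sval f (pres_q A j x).
Proof.
case: f => f [_ fmap] /=.
by rewrite -{1}(pres_map_q A x) -fmap pres_q_map.
Qed.

Lemma pres_hom_thin (hk : (0 < k)%N) A B (f g : pres_hom A B) : f = g.
Proof.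
apply: pres_hom_eq; apply/funext => a.
have [x <-] := pres_q_surj (Ordinal hk) a.
by rewrite -!pres_q_hom.
Qed.

Lemma pres_hom_iso A B (f : pres_hom A B) :
  is_iso (C := PowPres X k p) f.
Proof.
case: f => f fhom; have [[fb fd] fm] := fhom.
pose g := inverse (pres_nonempty A) f.
have fg : cancel g f by exact: inverseKV.
have ghom : @is_pres_hom _ _ _ _ B A g.
  split=> [|u]; first exact: is_isometry_inverse.
  by rewrite -fm; congr pres_map; apply/funext => j; exact: fg.
exists (exist _ g ghom); split; apply: pres_hom_eq; apply/funext => a /=.
  by apply: inverseK; exact: bij_inj.
exact: fg.
Qed.

Lemma pres_rel_equiv A j : RelationClasses.Equivalence (pres_rel A j).
Proof.
rewrite /pres_rel; split=> [x|x y|x y z]; first by [].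
  by move=> ->.
by move=> -> ->.
Qed.

Lemma pres_qbar_class A j x : @pres_qbar _ _ _ _ A j (class _ x) = pres_q A j x.
Proof. by apply: induced_class => //; exact: pres_rel_equiv. Qed.

Lemma pres_qbar_bij A j : bijective (@pres_qbar _ _ _ _ A j).
Proof.
apply: inj_surj_bijective => [C D|a].
  have [x ->] := class_surj C; have [y ->] := class_surj D.
  by rewrite !pres_qbar_class => xy; exact/(class_eqP (pres_rel_equiv A j)).
by have [x <-] := pres_q_surj j a; exists (class _ x); rewrite pres_qbar_class.
Qed.

Hypothesis p0 : 0 < p.

(** The distance between two values of [q_j] is at most the distance between
any points over them, and it is attained by keeping [x] and replacing the [j]-th
coordinate of [x] by that of [y]. *)
Lemma pres_qbar_isometry A j :
  is_isometry (@quotient_dist R X (pres_rel A j)) mdist (@pres_qbar _ _ _ _ A j).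
Proof.
split=> [|C D]; first exact: pres_qbar_bij.
have [x ->] := class_surj C; have [y ->] := class_surj D.
rewrite !pres_qbar_class; apply/esym/quotient_dist_min => [|x' y' xx' yy'].
  pose v i := if i == j then pres_q A j y else pres_q A i x.
  exists x, (pres_map v); split => //.
    by rewrite /in_class /= /pres_rel pres_q_map /v eqxx.
  rewrite (pres_mdist A) (@powdist_coord _ _ _ _ p0 _ _ j) ?pres_q_map /v ?eqxx//.
  by move=> i /negbTE ij; rewrite pres_q_map ij.
rewrite (xx' : _ = _) (yy' : _ = _) (pres_mdist A).
exact: (@coord_le_powdist _ _ _ _ p0 (pres_q A ^~ x') (pres_q A ^~ y')).
Qed.

Context (hX : inhabited X) (hk : (2 <= k)%N).

(** Through the isometries [qbar_j] every axiom becomes a statement about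
[P^k]: a choice of classes is a point of the power, and [tau_j] is the identity
of [P]. *)
Lemma F_data_wf A : is_power_structure p (F_data hX hk A).
Proof.
split=> /= [j|j|C|x y|j _].
- exact: pres_rel_equiv.
- have [qb qd] := pres_qbar_isometry A j.
  by apply: (is_metric_pullback (bij_inj qb) qd); exact: mdist_is_metric.
- have mem j x : in_class (C j) x <-> pres_q A j x = pres_qbar (C j).
    rewrite (in_classP (pres_rel_equiv A j)).
    split=> [->|]; rewrite -pres_qbar_class//.
    by move/(bij_inj (pres_qbar_bij A j)).
  exists (pres_map (fun j => pres_qbar (C j))); split=> [j|x Cx].
    by apply/mem; rewrite pres_q_map.
  by rewrite -(pres_map_q A x); congr pres_map; apply/funext => j; apply/esym/mem.
- rewrite (pres_mdist A); congr (_ `^ _); apply: eq_bigr => j _.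
  by rewrite -(pres_qbar_isometry A j).2 !pres_qbar_class.
- apply: is_isometry_comp (pres_qbar_isometry A j).
  exact: is_isometry_inverse (pres_qbar_isometry A _).
Qed.

(** Describes [tau_j] by the coordinate functions alone, without the inverse of
[qbar_1] that defines it. *)
Lemma pres_tau_eqP A j x y :
  pres_tau hX hk (A := A) (class (pres_rel A j) x) = class _ y <->
  pres_q A j x = pres_q A (ord_first hk) y.
Proof.
rewrite /pres_tau /= pres_qbar_class -(pres_qbar_class A (ord_first hk) y).
have qb := pres_qbar_bij A (ord_first hk).
split=> [<-|->]; first by rewrite inverseKV.
by rewrite inverseK//; exact: bij_inj.
Qed.
End presentations.

(** The maps [tau_j] are compared through their graphs pulled back to [X]: the
types of the two [tau_j] depend on the relations, so that they cannot be equated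
before the relations are.  One implication suffices because functional relations
that are total and included in one another coincide. *)
Lemma power_data_ext (X : Type) (k : nat) (hk : (2 <= k)%N)
    (s t : power_data X hk) :
  (forall j x y, rels s j x y <-> rels t j x y) ->
  (forall (j : 'I_k) (hj : (0 < j)%N) x y,
    taus hj (class (rels s j) x) = class _ y ->
    taus hj (class (rels t j) x) = class _ y) ->
  s = t.
Proof.
case: s t => [E sig] [E' tau] /= EE'.
have {EE'} : E = E'.
  by apply/funext => j; apply/funext => x; apply/funext => y; apply/propext.
move=> EE'; rewrite -EE' in tau * => sigtau; congr PowerData.
apply: functional_extensionality_dep => j.
apply: functional_extensionality_dep => hj; apply/funext => C.
have [x ->] := class_surj C; have [y xy] := class_surj (sig j hj (class _ x)).
by rewrite xy; apply/esym/sigtau.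
Qed.

(** All coordinate functions change by the same injection [f], which preserves
every equality between coordinates. *)
Lemma F_data_hom (R : realType) (X : metricType R) (hX : inhabited X) (k : nat)
    (hk : (2 <= k)%N) (p : R) (A B : presentation X k p) :
  pres_hom A B -> F_data hX hk A = F_data hX hk B.
Proof.
move=> f; have finj : injective (sval f).
  by case: f => f /= [[fb _] _]; exact: bij_inj.
apply: power_data_ext => /= [j x y|j _ x y].
  by rewrite /pres_rel !(pres_q_hom f); split=> [->//|/finj].
by rewrite !pres_tau_eqP !(pres_q_hom f) => ->.
Qed.

(** * From structures to presentations *)

Section structures.
Context (R : realType) (X : metricType R) (hX : inhabited X).
Context (k : nat) (hk : (2 <= k)%N) (p : R).
Implicit Types s : power_structure X hk p.

Lemma str_Psi_first s x : str_Psi s x (ord_first hk) = class _ x.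
Proof. by rewrite /str_Psi; destruct (boolP _). Qed.

Lemma str_Psi_tau s x (j : 'I_k) (hj : (0 < j)%N) :
  str_Psi s x j = taus hj (class (rels (sval s) j) x).
Proof.
rewrite /str_Psi; destruct (boolP _) as [hj'|hj0]; last by rewrite hj in hj0.
by rewrite (bool_irrelevance hj' hj).
Qed.

Lemma ord_first_or_pos (j : 'I_k) : j = ord_first hk \/ (0 < j)%N.
Proof. by case: (posnP j) => [j0|]; [left; exact: val_inj | right]. Qed.

(** Injectivity of [tau_j] makes the [j]-th component of [Psi] separate exactly
the classes of [E_j]; the first component is covered by the convention that
[tau_1] is the identity. *)
Lemma str_Psi_eqP s x y j : str_Psi s x j = str_Psi s y j <-> rels (sval s) j x y.
Proof.
have sP := svalP s; rewrite -(class_eqP (ps_equiv sP j)).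
have [->|hj] := ord_first_or_pos j; first by rewrite !str_Psi_first.
rewrite !(str_Psi_tau _ _ hj); split=> [|->//].
by have [/bij_inj + _] := ps_tau sP hj; apply.
Qed.

Lemma str_Psi_coord_surj s j (a : str_space s) : exists x, str_Psi s x j = a.
Proof.
have [->|hj] := ord_first_or_pos j.
  by have [x ->] := class_surj a; exists x; exact: str_Psi_first.
have [tb _] := ps_tau (svalP s) hj.
have [C <-] := bijective_surj tb a; have [x ->] := class_surj C.
by exists x; exact: str_Psi_tau.
Qed.

(** Both halves come from the unique intersection point: points with the same
image have the same classes, and a target is reached by choosing for each [j] a
class that [tau_j] sends to its [j]-th entry. *)
Lemma str_Psi_bij s : bijective (str_Psi s).
Proof.
have eqE := ps_equiv (svalP s).
apply: inj_surj_bijective => [x y xy|u].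
  have [z [_ zuniq]] := ps_point (svalP s) (fun j => class _ x).
  suff zE w : str_Psi s x = str_Psi s w -> z = w by rewrite -(zE x)// -(zE y).
  move=> xw; apply: zuniq => j; apply/(in_classP (eqE j))/(class_eqP (eqE j)).
  by apply/str_Psi_eqP; rewrite xw.
have /choice[c cP] : forall j, exists x, str_Psi s x j = u j.
  by move=> j; exact: str_Psi_coord_surj.
have [x [xP _]] := ps_point (svalP s) (fun j => class _ (c j)).
exists x; apply/funext => j; rewrite -cP; apply/esym/str_Psi_eqP.
exact/(class_eqP (eqE j))/(in_classP (eqE j)).
Qed.

Lemma str_Psi_isometry s :
  is_isometry mdist (@powdist R (str_space s) k p) (str_Psi s).
Proof.
split=> [|x y]; first exact: str_Psi_bij.
rewrite (ps_dist (svalP s)); congr (_ `^ _); apply: eq_bigr => j _.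
have [->|hj] := ord_first_or_pos j; first by rewrite !str_Psi_first.
by rewrite !(str_Psi_tau _ _ hj) -(ps_tau (svalP s) hj).2.
Qed.

Lemma str_Psi_inverse_isometry s :
  is_isometry (@powdist R (str_space s) k p) mdist (inverse hX (str_Psi s)).
Proof. exact: is_isometry_inverse (str_Psi_isometry s). Qed.

Hypothesis G_wf : forall s,
  is_isometry (@powdist R (str_space s) k p) mdist (inverse hX (str_Psi s)).

Lemma pres_q_G_obj s j x :
  pres_q (G_obj G_wf s) j x = str_Psi s x j.
Proof.
rewrite -[in LHS](inverseK hX (bij_inj (str_Psi_bij s)) x).
exact: (@pres_q_map _ _ _ _ (G_obj G_wf s)).
Qed.

Lemma F_data_G_obj s : F_data hX hk (G_obj G_wf s) = sval s.
Proof.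
apply: power_data_ext => /= [j x y|j hj x y].
  by rewrite /pres_rel !pres_q_G_obj str_Psi_eqP.
by rewrite pres_tau_eqP !pres_q_G_obj str_Psi_first (str_Psi_tau _ _ hj).
Qed.
End structures.

(** * Isomorphism classes and functors to discrete categories *)

Lemma isomorphic_refl (C : category) (a : C) : isomorphic a a.
Proof. by exists (idm a), (idm a); rewrite comp1m. Qed.

Lemma isomorphic_sym (C : category) (a b : C) :
  isomorphic a b -> isomorphic b a.
Proof. by move=> [f [g [gf fg]]]; exists g, f. Qed.

Lemma isomorphic_trans (C : category) (a b c : C) :
  isomorphic a b -> isomorphic b c -> isomorphic a c.
Proof.
move=> [f [f' [f'f ff']]] [g [g' [g'g gg']]].
exists (Defs.comp g f), (Defs.comp f' g'); split.
  by rewrite Defs.compA -(Defs.compA f') g'g compm1.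
by rewrite Defs.compA -(Defs.compA g) ff' compm1.
Qed.

Lemma iso_class_of_eq (C : category) (a b : C) :
  isomorphic a b -> iso_class_of a = iso_class_of b.
Proof.
move=> ab; apply: eq_exist; apply/funext => c; apply/propext.
by split; apply: isomorphic_trans => //; exact: isomorphic_sym.
Qed.

(** The hom-types of a discrete category are propositions, so that equality of
functors into it is decided on objects. *)
Lemma functor_discrete_ext (C : category) (T : Type)
    (F G : functor C (discrete_category T)) :
  (forall a, F a = G a) -> F = G.
Proof.
case: F G => [F Fm F1 FM] [G Gm G1 GM] /= FG.
have {FG} : F = G by exact/funext.
move=> FG; move: Fm F1 FM; rewrite FG => Fm F1 FM.
have FmG : Fm = Gm.
  by do 3 apply: functional_extensionality_dep => ?; exact: discrete_thin.
move: F1 FM; rewrite FmG => F1 FM.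
by rewrite (Prop_irrelevance F1 G1) (Prop_irrelevance FM GM).
Qed.

(** A functor to a discrete category is constant on isomorphism classes; a
strict section that is also an inverse up to isomorphism makes the induced map
bijective. *)
Lemma iso_class_classification (C : category) (T : Type)
    (F : functor C (discrete_category T))
    (G : T -> C) :
  (forall t, F (G t) = t) -> (forall a, isomorphic (G (F a)) a) ->
  exists Phi : iso_class C -> T,
    bijective Phi /\ forall a, Phi (iso_class_of a) = F a.
Proof.
move=> FG GF; pose Phi (S : iso_class C) : T := F (sval (cid (svalP S))).
have PhiE a : Phi (iso_class_of a) = F a.
  rewrite /Phi; case: cid => b /= ab.
  have [f _] : isomorphic a b by rewrite ab; exact: isomorphic_refl.
  exact: esym (Defs.fmap F f).
exists Phi; split=> //; exists (fun t => iso_class_of (G t)) => [S|t].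
  have [a ->] : exists a, S = iso_class_of a.
    by case: S => S HS; have [a Sa] := HS; exists a; exact: eq_exist.
  by rewrite PhiE; apply: iso_class_of_eq.
by rewrite PhiE.
Qed.

(** * The equivalence *)

Section unit.
Context (R : realType) (X : metricType R) (hX : inhabited X).
Context (k : nat) (hk : (2 <= k)%N) (p : R).
Hypothesis p0 : 0 < p.
Hypothesis F_wf : forall A : presentation X k p,
  is_power_structure p (F_data hX hk A).
Hypothesis G_wf : forall s : power_structure X hk p,
  is_isometry (@powdist R (str_space s) k p) mdist (inverse hX (str_Psi s)).

(** With [u = Psi x] the claim is that [qbar_1] turns the coordinates of [Psi x]
into those of [phi^-1 x], that is, [qbar_1 (tau_j C) = qbar_j C]. *)
Lemma pres_qbar_hom (A : presentation X k p) :
  @is_pres_hom _ _ _ _ (G_obj G_wf (F_obj F_wf A)) A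
    (@pres_qbar _ _ _ _ A (ord_first hk)).
Proof.
split=> [|u]; first exact: pres_qbar_isometry.
have [x <-] := bijective_surj (str_Psi_bij (F_obj F_wf A)) u.
have -> : pres_map (str_Psi (F_obj F_wf A) x : _ -> pres_space
    (G_obj G_wf (F_obj F_wf A))) = x.
  by apply: inverseK; exact/bij_inj/str_Psi_bij.
rewrite -{2}(pres_map_q A x); congr pres_map; apply/funext => j.
have [->|hj] := ord_first_or_pos hk j.
  by rewrite str_Psi_first pres_qbar_class.
rewrite (str_Psi_tau _ _ hj) /= /pres_tau /= pres_qbar_class.
by rewrite inverseKV//; exact: pres_qbar_bij.
Qed.

Definition pres_unit (A : presentation X k p) :
    pres_hom (G_obj G_wf (F_obj F_wf A)) A :=
  exist _ _ (pres_qbar_hom A).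
End unit.

Theorem theorem1p2 (R : realType) (X : metricType R) (hX : inhabited X)
    (k : nat) (hk : (2 <= k)%N) (p : R) (hp : 1 <= p) :
  (forall (A : presentation X k p) (j : 'I_k), bijective (@pres_qbar R X k p A j)) /\
  (forall s : power_structure X hk p, bijective (str_Psi s)) /\
  exists (F_wf : forall A : presentation X k p,
            is_power_structure p (F_data hX hk A))
         (F_hom : forall A B : presentation X k p,
            pres_hom A B -> F_obj F_wf A = F_obj F_wf B)
         (G_wf : forall s : power_structure X hk p,
            is_isometry (@powdist R (str_space s) k p) mdist
              (inverse hX (str_Psi s))),
  let F := F_functor F_hom in
  let G := G_functor G_wf in
  equivalence_of_categories F G /\
  functor_comp F G = functor_id (PowStr X hk p) /\
  (exists eta : nat_iso (functor_comp G F) (functor_id (PowPres X k p)),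
     forall A : presentation X k p,
       sval (eta A) = @pres_qbar R X k p A (ord_first hk)) /\
  (exists Phi : iso_class (PowPres X k p) -> power_structure X hk p,
     bijective Phi /\
     forall A : PowPres X k p, Phi (iso_class_of A) = F A) /\
  thin (PowPres X k p) /\
  trivial_automorphisms (PowPres X k p).
Proof.
have p0 : 0 < p by exact: lt_le_trans hp.
split; first exact: pres_qbar_bij.
split; first exact: str_Psi_bij.
pose F_wf (A : presentation X k p) := F_data_wf p0 hX hk A.
have F_hom (A B : presentation X k p) :
    pres_hom A B -> F_obj F_wf A = F_obj F_wf B.
  by move=> f; apply: eq_exist; exact: F_data_hom f.
exists F_wf, F_hom, (@str_Psi_inverse_isometry _ _ _ _ _ _).
set G_wf := @str_Psi_inverse_isometry _ _ _ _ _ _; move=> F G.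
have thinP : thin (PowPres X k p).
  by move=> A B; exact: pres_hom_thin (ltnW hk) _ _.
pose eta : nat_iso (functor_comp G F) (functor_id (PowPres X k p)) :=
  @NatIso _ _ (functor_comp G F) (functor_id _)
    (fun A => pres_unit p0 F_wf G_wf A) (fun A B f => thinP _ _ _ _)
    (fun A => pres_hom_iso _).
have FG (s : power_structure X hk p) : F (G s) = s :> power_structure X hk p.
  case: s => s sP; apply: eq_exist; exact: (F_data_G_obj G_wf (exist _ s sP)).
have FG1 : functor_comp F G = functor_id (PowStr X hk p).
  exact: functor_discrete_ext.
split.
  split; first exact: (inhabits eta).
  exists; exists (fun s => FG s) => [s t f|s]; first exact: discrete_thin.
  by exists (esym (FG s)); split; exact: discrete_thin.
split; first exact: FG1.
split; first by exists eta.
split.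
  apply: (iso_class_classification FG) => A.
  by exists (eta A); exact: (nt_iso eta A).
by split=> // A f _; exact: thinP.
Qed.
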